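(* Let $X$ be an ordered linear space equipped with a topology that turns it into a locally convex Hausdorff linear topological space, and suppose that the order interval $[0,x]$ is compact for every $x \in X_+$. Let $\mathcal L$ be the space of all continuous linear functionals $f : X \to \mathbb R$. Then $X$ satisfies the Riesz Decomposition Property if and only if $X$ satisfies the $\mathcal L$-Riesz Decomposition Property.
   Context: All linear spaces are over $\mathbb R$. An ordered linear space $X$ is a linear space with a partial order such that $x \geqslant y$ and $\lambda \geqslant 0$ imply $x+z \geqslant y+z$ and $\lambda x \geqslant \lambda y$; $X_+ = \{x \in X : x \geqslant 0\}$. The order interval is $[x,y] = \{z \in X : x \leqslant z \leqslant y\}$. Sums of sets are Minkowski sums. $X$ has the Riesz Decomposition Property if $[0,x]+[0,y] = [0,x+y]$ for all $x,y \in X_+$. For a linear functional $f : X \to \mathbb R$, a convex set $A \subset X$ and a point $z \in X$, $f$ strictly separates $z$ from $A$ if either $f(z) < \inf f(A)$ or $f(z) > \sup f(A)$. For a linear space $\mathcal L$ of linear functionals on $X$, $X$ satisfies the $\mathcal L$-Riesz Decomposition Property if for all $x, y \in X_+$ no point $z \in [0,x+y] \setminus ([0,x]+[0,y])$ can be strictly separated from $[0,x]+[0,y]$ by a functional from $\mathcal L$. *)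

(* Defs.v *)
From HB Require Import structures.
From mathcomp Require Import all_boot all_order all_algebra.
From mathcomp Require Import all_classical all_reals all_analysis.

Set Implicit Arguments.
Unset Strict Implicit.
Unset Printing Implicit Defensive.

Import Order.TTheory GRing.Theory Num.Theory.
Import numFieldNormedType.Exports.

Local Open Scope classical_set_scope.
Local Open Scope ring_scope.

HB.mixin Record POrderedZmodule_isOrderedLmodule (R : numDomainType) V
    & Num.POrderedZmodule V & GRing.Lmodule R V := {
  orderedlmod_leD2r : forall x y z : V, y <= x -> y + z <= x + z ;
  orderedlmod_leZ2l : forall (a : R) (x y : V),
    0 <= a -> y <= x -> a *: y <= a *: x
}.

#[short(type="orderedLmodType")]
HB.structure Definition OrderedLmodule (R : numDomainType) :=
  {V of POrderedZmodule_isOrderedLmodule R V & Num.POrderedZmodule V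
        & GRing.Lmodule R V}.

(* No compatibility between the order and the topology is required: in
   particular the positive cone need not be closed. Since [tvsType] does not
   include separation, the Hausdorff axiom has to be assumed separately. *)
#[short(type="orderedTvsType")]
HB.structure Definition OrderedTvs (R : numDomainType) :=
  {V of OrderedLmodule R V & Tvs R V}.

Definition set_add (V : zmodType) (A B : set V) : set V :=
  [set a + b | a in A & b in B].

Definition riesz_decomposition (R : realType) (X : orderedLmodType R) : Prop :=
  forall x y : X, 0 <= x -> 0 <= y ->
    set_add `[0, x]%classic `[0, y]%classic = `[0, x + y]%classic.

Record functional_space (R : realType) (X : lmodType R) := FunctionalSpace {
  functionals : set (X -> R^o) ;
  functionals_linear : forall f, functionals f -> linear f ;
  functionals_submod : submod_closed (mem functionals)
}.

(* The infimum and supremum are taken in the extended reals: the real-valued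
   [inf] and [sup] are 0 on unbounded sets. *)
Definition strictly_separates (R : realType) (X : lmodType R) (f : X -> R)
    (z : X) (A : set X) : Prop :=
  ((f z)%:E < ereal_inf [set (f a)%:E | a in A])%E \/
  (ereal_sup [set (f a)%:E | a in A] < (f z)%:E)%E.

Definition riesz_decomposition_wrt (R : realType) (X : orderedLmodType R)
    (L : functional_space X) : Prop :=
  forall x y : X, 0 <= x -> 0 <= y ->
  forall z : X,
    (`[0, x + y]%classic `\` set_add `[0, x]%classic `[0, y]%classic) z ->
    ~ exists2 f, functionals L f &
        strictly_separates f z (set_add `[0, x]%classic `[0, y]%classic).

Definition continuous_linear (R : realType) (X : tvsType R) : set (X -> R^o) :=
  [set f | linear f /\ continuous f].

Lemma continuous_linear_linear (R : realType) (X : tvsType R) (f : X -> R^o) :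
  continuous_linear f -> linear f.
Proof. by case. Qed.

Lemma continuous_linear_submod (R : realType) (X : tvsType R) :
  submod_closed (mem (@continuous_linear R X)).
Proof.
split=> [|a f g]; rewrite ?inE.
  split; last by move=> x; exact: cvg_cst.
  by move=> a u v; rewrite scaler0 addr0.
move=> [lf cf] [lg cg]; split=> [b u v|x].
  rewrite !fctE lf lg !scalerDr !scalerA [a * b]mulrC.
  by rewrite -!addrA; congr (_ + _); rewrite addrCA.
by apply: cvgD; [apply: cvgZr; exact: cf|exact: cg].
Qed.

Definition continuous_dual (R : realType) (X : tvsType R) :
    functional_space X :=
  FunctionalSpace (@continuous_linear_linear R X)
    (continuous_linear_submod X).

(* Main.v *)
Require Import Defs.
From mathcomp Require Import all_boot all_order all_algebra.
From mathcomp Require Import all_classical all_reals all_analysis.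
From HB Require Import structures.
From mathcomp Require Import lra.
Import Order.TTheory GRing.Theory Num.Theory.
Import numFieldNormedType.Exports.
Local Open Scope classical_set_scope.
Local Open Scope ring_scope.

(** Decomposition trivially leaves no point to separate. For the converse, put
A := [0, x] + [0, y]. It is contained in [0, x + y] for order reasons alone. It
is convex because order intervals are, and compact as the continuous image of
[0, x] * [0, y], hence closed since the space is Hausdorff. By the Hahn-Banach
theorem a point outside a closed convex set of a locally convex space is
strictly separated from it by a continuous linear functional
([closed_convex_separation]), so a point of [0, x + y] outside A would
contradict the separation form of the decomposition property.

The Hahn-Banach theorem is obtained without extending functionals from
subspaces. Zorn's lemma gives a pointwise minimal sublinear functional below any
given one ([exists_minimal_sublinear]). Such a functional q is linear: for each
y the functional x |-> inf_(t >= 0) (q (x + t y) - t q y) is again sublinear and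
below q, so it equals q, and t = 1 gives q x + q y <= q (x + y). Applying the
same modification once to the given p forces the minimal functional below it to
agree with p at y ([hahn_banach]).

For the separation, let a0 be a point of A and let W be a convex neighbourhood
of 0 such that z is not in A + W. The gauge of U := A - a0 + W is at most 1 on U
and at least 1 at z - a0, so a linear functional below the gauge and equal to it
at z - a0 is bounded above on a neighbourhood of 0, hence continuous, and
f (a + w) <= f z for all a in A and w in W. A multiple of z - a0 in W turns this
into a uniform gap.

The chain infima, the modification above and the gauge are all pointwise infima
of families of sets of reals; [inf_sublinear] isolates what makes such an
infimum sublinear. *)

(** * Sublinear functionals and the Hahn-Banach theorem *)

Lemma linear_functional_morph {R : realType} {V : lmodType R} (f : V -> R^o) :
  linear f ->
  [/\ forall x y, f (x - y) = f x - f y, forall x, f (- x) = - f x &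
      forall (a : R) x, f (a *: x) = a * f x].
Proof.
move=> lf.
pose F : {linear V -> R^o} := HB.pack f (GRing.isLinear.Build _ _ _ _ _ lf).
split=> [x y|x|a x]; first exact: (raddfB F).
  exact: (raddfN F).
exact: (linearZ_LR F).
Qed.

Definition sublinear {R : realType} {V : lmodType R} (q : V -> R) : Prop :=
  (forall x y, q (x + y) <= q x + q y) /\
  (forall t x, 0 < t -> q (t *: x) = t * q x).

Section sublinear_functionals.
Context {R : realType} {V : lmodType R}.
Implicit Types (p q : V -> R) (x y : V).

Lemma sublinear0 q : sublinear q -> q 0 = 0.
Proof.
move=> [_ hom]; have := hom 2 0 ltac:(by []).
by rewrite scaler0; lra.
Qed.

Lemma sublinear_geN q x : sublinear q -> - q (- x) <= q x.
Proof.
by move=> qS; have := qS.1 x (- x); rewrite subrr (sublinear0 _ qS); lra.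
Qed.

(** The sets S x need only be subadditive and positively homogeneous up to
smaller elements. Homogeneity is required as an inequality, because applying it
to t^-1 gives the reverse one. *)
Lemma inf_sublinear (S : V -> set R) :
  (forall x, S x !=set0) -> (forall x, has_lbound (S x)) ->
  (forall x y a b, S x a -> S y b -> exists2 c, S (x + y) c & c <= a + b) ->
  (forall t x a, 0 < t -> S x a -> exists2 c, S (t *: x) c & c <= t * a) ->
  sublinear (fun x => inf (S x)).
Proof.
move=> S0 Slb SD SZ.
have leS x a : S x a -> inf (S x) <= a by move=> /ge_inf; apply.
have infZ t x : 0 < t -> inf (S (t *: x)) <= t * inf (S x).
  move=> t0; rewrite -ler_pdivrMl//; apply: lb_le_inf => // a Sa.
  have [c /leS Sc ca] := SZ t x a t0 Sa.
  by rewrite ler_pdivrMl// (le_trans Sc).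
split=> [x y|t x t0].
  rewrite -lerBlDr; apply: lb_le_inf => // a Sa.
  rewrite lerBlDr -lerBlDl; apply: lb_le_inf => // b Sb.
  have [c /leS Sc cab] := SD x y a b Sa Sb.
  by rewrite lerBlDl (le_trans Sc).
apply/eqP; rewrite eq_le infZ//= -ler_pdivlMl//.
have := infZ t^-1 (t *: x); rewrite invr_gt0 => /(_ t0).
by rewrite scalerA mulVf ?gt_eqF// scale1r.
Qed.

(** Being a chain matters for subadditivity only: q x + r y is bounded below by
m x + m y for the smaller m of q and r. *)
Lemma inf_chain_sublinear (F : set (V -> R)) (b : V -> R) : F !=set0 ->
  (forall q, F q -> sublinear q) -> (forall q x, F q -> b x <= q x) ->
  total_on F (fun q r => forall x, r x <= q x) ->
  sublinear (fun x => inf [set q x | q in F]).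
Proof.
move=> [q0 Fq0] Fsub Fb Ftot; apply: inf_sublinear.
- by move=> x; exists (q0 x), q0.
- by move=> x; exists (b x) => _ [q Fq <-]; exact: Fb.
- move=> x y _ _ [q Fq <-] [r Fr <-].
  have [rq|qr] := Ftot q r Fq Fr.
    exists (r (x + y)); first by exists r.
    by rewrite (le_trans ((Fsub r Fr).1 x y))// lerD2r.
  exists (q (x + y)); first by exists q.
  by rewrite (le_trans ((Fsub q Fq).1 x y))// lerD2l.
- move=> t x _ t0 [q Fq <-]; exists (q (t *: x)); first by exists q.
  by rewrite (Fsub q Fq).2.
Qed.

(** The functional r is x |-> inf_(t >= 0) (q (x + t y) - t q y); the bounds are
the terms t = 0 and t = 1. It serves twice: with q minimal it forces q to be
additive, and at x = - y it gives r (- y) <= - q y, which forces a linear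
functional below r to be at least q y at y. *)
Lemma shift_sublinear q y : sublinear q ->
  exists r, [/\ sublinear r, forall x, r x <= q x &
                forall x, r x <= q (x + y) - q y].
Proof.
move=> qS; have [subq homq] := qS.
have hom0 t x : 0 <= t -> q (t *: x) = t * q x.
  rewrite le_eqVlt => /predU1P[<-|/homq//].
  by rewrite scale0r mul0r sublinear0.
pose S x := [set q (x + t *: y) - t * q y | t in [set t | 0 <= t]].
have Slb x : has_lbound (S x).
  (* t q y = q (t y) and t y is the sum of x + t y and - x *)
  exists (- q (- x)) => _ [t /= t0 <-].
  have := subq (x + t *: y) (- x).
  by rewrite addrAC subrr add0r hom0//; lra.
have leS x t : 0 <= t -> inf (S x) <= q (x + t *: y) - t * q y.
  by move=> t0; apply: ge_inf => //; exists t.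
exists (fun x => inf (S x)); split.
- apply: inf_sublinear => //.
  + by move=> x; exists (q (x + 0 *: y) - 0 * q y), 0 => /=.
  + move=> x x' _ _ [s /= s0 <-] [t /= t0 <-].
    exists (q (x + x' + (s + t) *: y) - (s + t) * q y).
      by exists (s + t) => //=; exact: addr_ge0.
    have := subq (x + s *: y) (x' + t *: y).
    by rewrite addrACA -scalerDl; lra.
  + move=> t x _ t0 [s /= s0 <-].
    exists (q (t *: x + (t * s) *: y) - (t * s) * q y).
      by exists (t * s) => //=; rewrite mulr_ge0// ltW.
    by rewrite -scalerA -scalerDr homq//; lra.
- by move=> x; have := leS x 0 (lexx _); rewrite scale0r addr0; lra.
- by move=> x; have := leS x 1 ler01; rewrite scale1r; lra.
Qed.

Definition minimal_sublinear q :=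
  sublinear q /\
  forall r, sublinear r -> (forall x, r x <= q x) -> forall x, q x <= r x.

Lemma minimal_sublinear_linear q :
  minimal_sublinear q -> linear (q : V -> R^o).
Proof.
move=> [qS qmin]; have [subq homq] := qS.
have qD x y : q (x + y) = q x + q y.
  have [r [rS rq rqy]] := shift_sublinear q y qS.
  apply/eqP; rewrite eq_le subq/=.
  by have := qmin r rS rq x; have := rqy x; lra.
have qN x : q (- x) = - q x.
  by have := qD x (- x); rewrite subrr sublinear0//; lra.
move=> a x y; rewrite qD; congr (_ + _).
change (q (a *: x) = a * q x).
have [a0|a0|->] := ltgtP a 0; last by rewrite scale0r mul0r sublinear0.
  by rewrite -[a]opprK scaleNr qN homq ?oppr_gt0// !mulNr.
exact: homq.
Qed.

(** Zorn's lemma applies to the sublinear functionals below p because they have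
the common lower bound x |-> - p (- x), so the pointwise infimum of a chain is
real-valued. *)
Lemma exists_minimal_sublinear p : sublinear p ->
  exists2 q, minimal_sublinear q & forall x, q x <= p x.
Proof.
move=> pS; pose T := {q : V -> R | sublinear q /\ forall x, q x <= p x}.
pose below (q r : T) : bool := `[< forall x, sval r x <= sval q x >].
have [|||q qmin] := @ZL_preorder T (exist _ p (conj pS (fun=> lexx _))) below.
- by move=> q; apply/asboolP.
- move=> q r s /asboolP rq /asboolP sr; apply/asboolP => x.
  exact: le_trans (sr x) (rq x).
- move=> A Atot; have [[q0 Aq0]|A0] := pselect (A !=set0); last first.
    by exists (exist _ p (conj pS (fun=> lexx _))) => s As; case: A0; exists s.
  pose F := [set sval q | q in A].
  have Flb r x : F r -> - p (- x) <= r x.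
    move=> [[/= s [sS sp]] _ <-].
    by rewrite (le_trans _ (sublinear_geN s x sS))// lerN2.
  have leF r x : F r -> inf [set q x | q in F] <= r x.
    move=> Fr; apply: ge_inf; last by exists r.
    by exists (- p (- x)) => _ [s Fs <-]; exact: Flb.
  have FS : sublinear (fun x => inf [set q x | q in F]).
    apply: (inf_chain_sublinear F (fun x => - p (- x))) => //.
    - by exists (sval q0), q0.
    - by move=> _ [[s [sS ?]] _ <-].
    - move=> _ _ [q Aq <-] [r Ar <-].
      by have [/asboolP|/asboolP] := Atot q r Aq Ar; [left|right].
  have Fp x : inf [set q x | q in F] <= p x.
    rewrite (le_trans (leF (sval q0) x _))//; first by exists q0.
    exact: (svalP q0).2.
  exists (exist (fun q => sublinear q /\ forall x, q x <= p x) _ (conj FS Fp)).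
  move=> s As.
  by apply/asboolP => x; apply: leF; exists s.
- have [qS qp] := svalP q.
  exists (sval q) => //; split=> // r rS rq.
  have rp x : r x <= p x := le_trans (rq x) (qp x).
  have /asboolP := qmin (exist _ r (conj rS rp)) ltac:(exact/asboolP).
  by [].
Qed.

Theorem hahn_banach p y : sublinear p ->
  exists f : V -> R^o, [/\ linear f, forall x, f x <= p x & f y = p y].
Proof.
move=> pS; have [r [rS rp rpy]] := shift_sublinear p y pS.
have [f fmin fr] := exists_minimal_sublinear r rS.
have fS := fmin.1.
exists f; split=> [|x|]; first exact: minimal_sublinear_linear.
  exact: le_trans (fr x) (rp x).
apply/eqP; rewrite eq_le (le_trans (fr y))//=.
have := le_trans (fr (- y)) (rpy (- y)); rewrite addNr sublinear0//.
by have := sublinear_geN f y fS; lra.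
Qed.

End sublinear_functionals.

(** * Convex sets and gauges *)

Section convex_sets.
Context {R : realType} {V : lmodType R}.
Implicit Types (A B : set V) (x y : V).

Lemma convex_setE A : convex_set A <->
  forall x y (s t : R), 0 <= s -> 0 <= t -> s + t = 1 -> A x -> A y ->
    A (s *: x + t *: y).
Proof.
split=> [cA x y s t s0 t0 st Ax Ay|cA x y k /set_mem Ax /set_mem Ay].
  have s1 : s <= 1 by rewrite -st lerDl.
  have := cA x y (Itv01 s0 s1) (mem_set Ax) (mem_set Ay).
  move=> /set_mem; rewrite /conv/=/unstable.onem.
  by have -> : 1 - s = t by rewrite -st addrAC subrr add0r.
apply/mem_set; apply: cA => //.
- by rewrite subr_ge0.
- by rewrite addrCA subrr addr0.
Qed.

Lemma convex_set_add A B :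
  convex_set A -> convex_set B -> convex_set (set_add A B).
Proof.
move=> /convex_setE cA /convex_setE cB; apply/convex_setE.
move=> _ _ s t s0 t0 st [a Aa [b Bb <-]] [a' Aa' [b' Bb' <-]].
rewrite !scalerDr addrACA.
by exists (s *: a + t *: a'); [exact: cA|exists (s *: b + t *: b'); [exact: cB|]].
Qed.

Lemma convex_set1 x : convex_set [set x].
Proof.
by apply/convex_setE => _ _ s t _ _ st -> ->; rewrite -scalerDl st scale1r.
Qed.

Definition absorbing A := forall x, exists2 t : R, 0 < t & A (t^-1 *: x).

Definition gauge A x : R := inf [set t | 0 < t /\ A (t^-1 *: x)].

Lemma gauge_lb A x : lbound [set t | 0 < t /\ A (t^-1 *: x)] 0.
Proof. by move=> t [/ltW]. Qed.

(** Convexity gives subadditivity: if x / s and y / t lie in A, then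
(x + y) / (s + t) is their convex combination with weights s / (s + t) and
t / (s + t). *)
Lemma gauge_sublinear A : convex_set A -> absorbing A -> sublinear (gauge A).
Proof.
move=> /convex_setE cA absA; apply: inf_sublinear.
- by move=> x; have [t t0 At] := absA x; exists t.
- by move=> x; exists 0; exact: gauge_lb.
- move=> x y s t [s0 As] [t0 At]; exists (s + t) => //; split.
    exact: addr_gt0.
  have st0 : s + t != 0 by rewrite gt_eqF// addr_gt0.
  have -> : (s + t)^-1 *: (x + y) =
      (s / (s + t)) *: (s^-1 *: x) + (t / (s + t)) *: (t^-1 *: y).
    by rewrite !scalerA ![_ / (s + t)]mulrC !mulfK ?gt_eqF// scalerDr.
  apply: cA => //; last by rewrite -mulrDl mulfV.
    by rewrite divr_ge0 ?addr_ge0 ?ltW.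
  by rewrite divr_ge0 ?addr_ge0 ?ltW.
- move=> t x a t0 [a0 Aa]; exists (t * a) => //; split; first exact: mulr_gt0.
  by rewrite scalerA invfM mulrAC mulVf ?gt_eqF// mul1r.
Qed.

Lemma gauge_le1 A x : A x -> gauge A x <= 1.
Proof.
move=> Ax; apply: ge_inf; first by exists 0; exact: gauge_lb.
by split; rewrite ?ltr01// invr1 scale1r.
Qed.

(** If x / t is in A with t < 1, then x is on the segment from 0 to x / t. *)
Lemma gauge_ge1 A x :
  convex_set A -> absorbing A -> A 0 -> ~ A x -> 1 <= gauge A x.
Proof.
move=> /convex_setE cA absA A0 nAx.
apply: lb_le_inf; first by have [t t0 At] := absA x; exists t.
move=> t [t0 At]; rewrite leNgt; apply/negP => t1; apply: nAx.
have -> : x = t *: (t^-1 *: x) + (1 - t) *: 0.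
  by rewrite scaler0 addr0 scalerA mulfV ?gt_eqF// scale1r.
apply: cA => //; first exact: ltW.
- by rewrite subr_ge0 ltW.
- by rewrite addrCA subrr addr0.
Qed.

End convex_sets.

(** * Separation in locally convex spaces *)

Section separation.
Context {R : realType} {V : tvsType R}.
Implicit Types (A W : set V) (x z : V).

Lemma nbhs0_absorbing W : nbhs 0 W -> absorbing W.
Proof.
move=> W0 x; have := @scale_continuous R V (0, x) W; rewrite /= scale0r.
move=> /(_ W0) [[/= I J] [/= I0 Jx] IJ].
have [e /= e0 eI] := I0.
exists (e / 2)^-1; first by rewrite invr_gt0 divr_gt0.
rewrite invrK; apply: (IJ (e / 2, x)); split => /=; last exact: nbhs_singleton.
by apply: eI; rewrite /= sub0r normrN gtr0_norm ?divr_gt0//; lra.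
Qed.

(** An upper bound suffices: on the symmetric neighbourhood W `&` - W of 0,
f is bounded by 1 in absolute value, and e times that neighbourhood, translated
to x, witnesses continuity at x. *)
Lemma linear_continuous_bounded_nbhs0 (f : V -> R^o) W :
  linear f -> nbhs 0 W -> (forall w, W w -> f w <= 1) -> continuous f.
Proof.
move=> lf W0 fW x.
have [fB fN fZ] := linear_functional_morph f lf.
apply/cvgrPdist_le => e e0.
apply: filterS (nbhsT x (nbhs0Z (lt0r_neq0 e0) (filterI W0 (nbhs0N W0)))).
move=> _ [_ [w [Ww [w' Ww' w'w]] <-] <-].
rewrite -fB opprD addrA subrr add0r -scalerN fZ normrM gtr0_norm//.
have fw : f w <= 1 := fW w Ww.
have fNw : - f w <= 1 by rewrite -fN -w'w opprK; exact: fW.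
by rewrite ler_piMr ?(ltW e0)// ler_norml fN lerN2 fw fNw.
Qed.

(** The gap e is uniform in a, so that the supremum of f over A stays strictly
below f z. *)
Theorem closed_convex_separation A z :
  closed A -> convex_set A -> A !=set0 -> ~ A z ->
  exists f : V -> R^o, exists2 e : R, 0 < e &
    [/\ linear f, continuous f & forall a, A a -> f a + e <= f z].
Proof.
move=> clA cA [a0 Aa0] nAz.
have nN : nbhs (0 : V) [set w | (~` A) (z - w)].
  have := @sub_continuous V (z, 0) (~` A).
  rewrite /= subr0 => /(_ (open_nbhs_nbhs (conj (closed_openC clA) nAz))).
  move=> [[/= I J] [/= Iz J0] IJ]; apply: filterS J0 => w Jw.
  by apply: (IJ (z, w)); split => //=; exact: nbhs_singleton.
have [B cB [oB /(_ 0 _ nN)[W [BW W0] WN]]] := @locally_convex R V.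
have nW : nbhs 0 W by apply: open_nbhs_nbhs; split => //; exact: oB.
have {}cW : convex_set W by apply: cB; exact: mem_set.
pose U := set_add (set_add A [set - a0]) W.
have AWU a w : A a -> W w -> U (a - a0 + w).
  by move=> Aa Ww; exists (a - a0); [exists a => //; exists (- a0)|exists w].
have WU : W `<=` U by move=> w Ww; rewrite -[w]add0r -(subrr a0); exact: AWU.
have U0 : nbhs 0 U by exact: filterS nW.
have cU : convex_set U.
  by do 2![apply: convex_set_add => //]; exact: convex_set1.
have absU := nbhs0_absorbing U U0.
have nU : ~ U (z - a0).
  move=> [_ [a Aa [_ -> <-]] [w Ww zE]]; apply: (WN w Ww).
  suff -> : z - w = a by [].
  by rewrite -[z](subrK a0) -zE addrAC addrK subrK.
have [f [lf fU fz]] := hahn_banach (gauge U) (z - a0) (gauge_sublinear U cU absU).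
have [fB _ fZ] := linear_functional_morph f lf.
have fU1 u : U u -> f u <= 1.
  by move=> Uu; apply: le_trans (fU u) _; exact: gauge_le1.
have fz1 : 1 <= f (z - a0).
  by rewrite fz gauge_ge1//; exact: nbhs_singleton.
(* f (t^-1 (z - a0)) >= t^-1 > 0: this element of W yields the gap *)
have [t t0 Wt] := nbhs0_absorbing W nW (z - a0).
exists f, t^-1; first by rewrite invr_gt0.
split=> //; first by apply: (linear_continuous_bounded_nbhs0 f U).
move=> a Aa; have := fU1 _ (AWU a _ Aa Wt).
have -> : a - a0 + t^-1 *: (z - a0) = a - (a0 - t^-1 *: (z - a0)).
  by rewrite opprB addrA addrAC.
rewrite fB [f (a0 - _)]fB fZ.
have : t^-1 <= t^-1 * f (z - a0) by rewrite ler_peMr// invr_ge0 ltW.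
by move: fz1; rewrite fB; lra.
Qed.

End separation.

(** * Order intervals and the decomposition property *)

Section order_intervals.
Context {R : realType} {X : orderedLmodType R}.
Implicit Types x y z : X.

Lemma orderedlmod_leD (a b c d : X) : a <= b -> c <= d -> a + c <= b + d.
Proof.
move=> ab cd; apply: (le_trans (orderedlmod_leD2r b a c ab)).
by rewrite ![b + _]addrC; exact: orderedlmod_leD2r.
Qed.

Lemma set_add_itv0_sub x y :
  set_add `[0, x]%classic `[0, y]%classic `<=` `[0, x + y]%classic.
Proof.
move=> _ [a + [b + <-]]; rewrite /= !in_itv/= => /andP[a0 ax] /andP[b0 bx].
by apply/andP; split; [rewrite -[0]addr0|]; exact: orderedlmod_leD.
Qed.

Lemma convex_set_itv x y : convex_set (`[x, y]%classic : set X).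
Proof.
apply/convex_setE => a b s t s0 t0 st; rewrite /= !in_itv/=.
move=> /andP[xa ay] /andP[xb bY].
rewrite -[x]scale1r -[y]scale1r -st !scalerDl.
by apply/andP; split; apply: orderedlmod_leD; exact: orderedlmod_leZ2l.
Qed.

End order_intervals.

Lemma compact_set_add {R : realType} {V : tvsType R} (A B : set V) :
  compact A -> compact B -> compact (set_add A B).
Proof.
move=> cA cB.
have -> : set_add A B = (fun p : V * V => p.1 + p.2) @` (A `*` B).
  apply/seteqP; split=> [_ [a Aa [b Bb <-]]|_ [[a b] [/= Aa Bb] <-]].
    by exists (a, b).
  by exists a => //; exists b.
apply: continuous_compact; last exact: compact_setX.
by apply: continuous_subspaceT; exact: add_continuous.
Qed.

Theorem proposition2 (R : realType) (X : orderedTvsType R)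
    (X_hausdorff : hausdorff_space X)
    (compact_itv : forall x : X, 0 <= x -> compact `[0, x]%classic) :
  riesz_decomposition X <-> riesz_decomposition_wrt (continuous_dual X).
Proof.
split=> [rdp x y x0 y0 z|rdp x y x0 y0]; first by rewrite rdp// setDv.
apply/seteqP; split; first exact: set_add_itv0_sub.
move=> z zxy; apply: contrapT => nz.
have [||||f [e e0 [lf cf fz]]] :=
  closed_convex_separation (set_add `[0, x]%classic `[0, y]%classic) z.
- by apply: compact_closed => //; apply: compact_set_add; exact: compact_itv.
- by apply: convex_set_add; exact: convex_set_itv.
- exists (0 + 0); exists 0; last exists 0 => //.
    by rewrite /= in_itv/= lexx.
  by rewrite /= in_itv/= lexx.
- by [].
apply: (rdp x y x0 y0 z); first by split.
exists f; first by split.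
right; apply: (@le_lt_trans _ _ (f z - e)%:E); last by rewrite lte_fin; lra.
apply: ge_ereal_sup => _ [a Aa <-].
by rewrite lee_fin lerBrDr; exact: fz.
Qed.
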